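(* Let $d\ge 1$, let $a_0,\ldots,a_d$ be positive numbers and let $a=a_0+\cdots+a_d$. Let $X$, $Y$, $B$ be independent random variables such that $X\sim\mathcal{D}(a_0,\ldots,a_d)$ and $B\sim\sum_{i=0}^d\frac{a_i}{a}\delta_{e_i}$ are valued in $\mathbb{R}^{d+1}$, and $Y\sim\beta(1,a)$ is real valued. Then $$X\sim X(1-Y)+BY .$$
   Context: $e_0,\ldots,e_d$ is the natural basis of $\mathbb{R}^{d+1}$ and $\delta_{e_i}$ is the Dirac mass at $e_i$. The notation $U\sim V$ between random variables means equality in distribution, and $U\sim\mu$ means that $U$ has law $\mu$. For $p,q>0$, $\beta(p,q)$ is the law on $(0,1)$ with density $\frac{\Gamma(p+q)}{\Gamma(p)\Gamma(q)}x^{p-1}(1-x)^{q-1}$. For $a_0,\ldots,a_d>0$, the Dirichlet distribution $\mathcal{D}(a_0,\ldots,a_d)$ is the law of $X=(X_0,\ldots,X_d)$ with $X_0=1-X_1-\cdots-X_d$ such that $(X_1,\ldots,X_d)$ has density $\frac{\Gamma(a_0+\cdots+a_d)}{\Gamma(a_0)\cdots\Gamma(a_d)}(1-x_1-\cdots-x_d)^{a_0-1}x_1^{a_1-1}\cdots x_d^{a_d-1}$ on the set where $x_1,\ldots,x_d>0$ and $x_1+\cdots+x_d<1$. *)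

(* Defs.v *)
From HB Require Import structures.
From mathcomp Require Import all_boot all_order all_algebra.
From mathcomp Require Import all_classical all_reals all_analysis.
From mathcomp Require Import measurable_realfun.

Set Implicit Arguments.
Unset Strict Implicit.
Unset Printing Implicit Defensive.

Import Order.TTheory GRing.Theory Num.Theory.
Import numFieldNormedType.Exports.

Local Open Scope classical_set_scope.
Local Open Scope ring_scope.

(* R^n is n.-tuple R with its product sigma-algebra; Lebesgue measure on it is
   built by adding one coordinate at a time. measurableTypeR R is the copy of R
   that carries lebesgue_measure; its sigma-algebra is convertible to that of R. *)

Definition tuple_cons (R : realType) (n : nat)
  (p : measurableTypeR R * n.-tuple R) : n.+1.-tuple R := [tuple of p.1 :: p.2].

Lemma measurable_tuple_cons (R : realType) (n : nat) :
  measurable_fun setT (@tuple_cons R n).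
Proof.
apply: (@measurable_cons _ _ _ R (fun p => p.1 : R) n snd) => //.
exact: measurable_fst.
Qed.

Section lebesgue_cons.
Variables (R : realType) (n : nat).
Variable m : {sigma_finite_measure set (n.-tuple R) -> \bar R}.

Definition lebesgue_cons : set (n.+1.-tuple R) -> \bar R :=
  pushforward (@lebesgue_measure R \x m)%E (@tuple_cons R n).

Let m' : {measure set (n.+1.-tuple R) -> \bar R} :=
  measure_function_pushforward__canonical__measure_function_Measure
    (@lebesgue_measure R \x m)%E (@measurable_tuple_cons R n).

HB.instance Definition _ := isMeasure.Build _ _ _ lebesgue_cons
  (measure0 m') (measure_ge0 m') (@measure_semi_sigma_additive _ _ _ m').

Lemma lebesgue_cons_sigma_finite : sigma_finite setT lebesgue_cons.
Proof.
have /sigma_finiteP[F [FT ndF mF]] := sigma_finiteT (@lebesgue_measure R).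
have /sigma_finiteP[G [GT ndG mG]] := sigma_finiteT m.
pose uncons (t : n.+1.-tuple R) : measurableTypeR R * n.-tuple R :=
  (thead t, [tuple of behead t]).
have munc : measurable_fun setT uncons.
  apply/measurable_fun_pair; first exact: measurable_tnth.
  exact: measurable_behead.
exists (fun k => uncons @^-1` (F k `*` G k)).
  apply/seteqP; split => // t _.
  have [i _ Fi] : (\bigcup_k F k) (thead t) by rewrite -FT.
  have [j _ Gj] : (\bigcup_k G k) [tuple of behead t] by rewrite -GT.
  exists (maxn i j) => //; split => /=.
    by move: Fi; exact/subsetPset/ndF/leq_maxl.
  by move: Gj; exact/subsetPset/ndG/leq_maxr.
move=> k; have [mFk Fk] := mF k; have [mGk Gk] := mG k; split.
  by rewrite -[X in measurable X]setTI; apply: munc => //; exact: measurableX.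
rewrite /lebesgue_cons /pushforward -comp_preimage.
rewrite (_ : uncons \o _ = id); last first.
  by apply/funext => -[x t]; congr (_, _); exact: val_inj.
by rewrite preimage_id product_measure1E // lte_mul_pinfty // ge0_fin_numE.
Qed.

HB.instance Definition _ := Measure_isSigmaFinite.Build _ _ _ lebesgue_cons
  lebesgue_cons_sigma_finite.

End lebesgue_cons.

Fixpoint lebesgue_tuple (R : realType) (n : nat) :
    {sigma_finite_measure set (n.-tuple R) -> \bar R} :=
  match n with
  | 0 => \d_([tuple] : 0.-tuple R)
  | n'.+1 => lebesgue_cons (lebesgue_tuple R n')
  end.

Lemma lebesgue_tuple_box (R : realType) (n : nat) (A : 'I_n -> set R) :
  (forall i, measurable (A i)) ->
  lebesgue_tuple R n [set t | forall i, A i (tnth t i)] =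
  (\prod_(i < n) @lebesgue_measure R (A i))%E.
Proof.
elim: n A => [|n IH] A mA.
  by rewrite big_ord0 /= diracE mem_set // => -[].
rewrite big_ord_recl -IH //= /lebesgue_cons /pushforward.
rewrite -product_measure1E //; last first.
  rewrite (_ : [set _ | _] = \bigcap_(i in [set: 'I_n])
      ((fun t : n.-tuple R => tnth t i) @^-1` A (lift ord0 i))).
    apply: fin_bigcap_measurable => // i _; rewrite -[X in measurable X]setTI.
    exact: measurable_tnth.
  by apply/seteqP; split => [t /= tA i _|t tA i]; exact: tA.
  exact: mA.
congr ((@lebesgue_measure R \x lebesgue_tuple R n)%E _).
apply/seteqP; split => -[x t] /=.
  move=> tA; split=> [|i]; first by have := tA ord0.
  by have := tA (lift ord0 i); rewrite tnthS.
move=> [xA tA] i; case: (unliftP ord0 i) => [j ->|->] //.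
by rewrite tnthS; exact: tA.
Qed.

(* Euler's integral: meaningful for s > 0 only. *)
Definition Gamma (R : realType) (s : R) : R :=
  (\int[@lebesgue_measure R]_(x in `]0%R, +oo[) (x `^ (s - 1) * expR (- x)))%R.

Definition beta_density (R : realType) (p q x : R) : R :=
  if 0 < x < 1 then
    Gamma (p + q) / (Gamma p * Gamma q) * x `^ (p - 1) * (1 - x) `^ (q - 1)
  else 0.

Definition beta_law (R : realType) (p q : R) (A : set R) : \bar R :=
  (\int[@lebesgue_measure R]_(x in A) (beta_density p q x)%:E)%E.

Definition dirichlet_density (R : realType) (d : nat) (a : 'I_d.+1 -> R)
    (x : d.-tuple R) : R :=
  if [forall i, 0 < tnth x i] && (\sum_(i < d) tnth x i < 1) then
    Gamma (\sum_(i < d.+1) a i) / (\prod_(i < d.+1) Gamma (a i)) *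
    (1 - \sum_(i < d) tnth x i) `^ (a ord0 - 1) *
    \prod_(i < d) tnth x i `^ (a (lift ord0 i) - 1)
  else 0.

(* The density is that of (X_1, ..., X_d); X_0 is the first coordinate. *)
Definition simplex_point (R : realType) (d : nat) (x : d.-tuple R) :
  d.+1.-tuple R := [tuple of (1 - \sum_(i < d) tnth x i) :: x].

Definition dirichlet_law (R : realType) (d : nat) (a : 'I_d.+1 -> R)
    (A : set (d.+1.-tuple R)) : \bar R :=
  (\int[lebesgue_tuple R d]_(x in @simplex_point R d @^-1` A)
    (dirichlet_density a x)%:E)%E.

Definition basis_vec (R : realType) (n : nat) (i : 'I_n) : n.-tuple R :=
  [tuple (i == j)%:R | j < n].

Definition basis_law (R : realType) (d : nat) (a : 'I_d.+1 -> R)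
    (A : set (d.+1.-tuple R)) : \bar R :=
  (\sum_(i < d.+1) (a i / \sum_(j < d.+1) a j)%:E * \d_(@basis_vec R d.+1 i) A)%E.

(* Laws are compared on measurable sets only: the library's set functions are
   total, with irrelevant values on the other sets. *)
Definition has_law (d d' : measure_display) (T : measurableType d)
    (T' : measurableType d') (R : realType) (P : probability T R)
    (U : {RV P >-> T'}) (mu : set T' -> \bar R) : Prop :=
  forall A, measurable A -> distribution P U A = mu A.

Definition eq_law (d d' : measure_display) (T : measurableType d)
    (T' : measurableType d') (R : realType) (P : probability T R)
    (U V : {RV P >-> T'}) : Prop :=
  has_law U (distribution P V).

(* Taking some of the sets to be setT gives the product rule for pairs. *)
Definition independent3 (d d1 d2 d3 : measure_display) (T : measurableType d)
    (T1 : measurableType d1) (T2 : measurableType d2) (T3 : measurableType d3)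
    (R : realType) (P : probability T R)
    (U1 : {RV P >-> T1}) (U2 : {RV P >-> T2}) (U3 : {RV P >-> T3}) : Prop :=
  forall A1 A2 A3, measurable A1 -> measurable A2 -> measurable A3 ->
  P (U1 @^-1` A1 `&` U2 @^-1` A2 `&` U3 @^-1` A3) =
  (P (U1 @^-1` A1) * P (U2 @^-1` A2) * P (U3 @^-1` A3))%E.

Section vector_random_variables.
Variables (disp : measure_display) (T : measurableType disp) (R : realType).
Variable n : nat.

Definition rv_add (U V : T -> n.-tuple R) (w : T) : n.-tuple R :=
  [tuple tnth (U w) i + tnth (V w) i | i < n].

Definition rv_scale (Y : T -> R) (U : T -> n.-tuple R) (w : T) : n.-tuple R :=
  [tuple Y w * tnth (U w) i | i < n].

Lemma measurable_rv_add (U V : {mfun T >-> n.-tuple R}) :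
  measurable_fun setT (rv_add U V).
Proof.
apply/measurable_fun_tnthP => i.
rewrite (_ : _ \o _ = (fun w => tnth (U w) i) \+ (fun w => tnth (V w) i)).
  by apply: measurable_funD; apply: (measurableT_comp (measurable_tnth i)).
by apply/funext => w /=; rewrite tnth_mktuple.
Qed.

Lemma measurable_rv_scale (Y : {mfun T >-> R}) (U : {mfun T >-> n.-tuple R}) :
  measurable_fun setT (rv_scale Y U).
Proof.
apply/measurable_fun_tnthP => i.
rewrite (_ : _ \o _ = Y \* (fun w => tnth (U w) i)).
  apply: measurable_funM => //.
  exact: (measurableT_comp (measurable_tnth i)).
by apply/funext => w /=; rewrite tnth_mktuple.
Qed.

HB.instance Definition _ (U V : {mfun T >-> n.-tuple R}) :=
  isMeasurableFun.Build _ _ _ _ (rv_add U V) (measurable_rv_add U V).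
HB.instance Definition _ (Y : {mfun T >-> R}) (U : {mfun T >-> n.-tuple R}) :=
  isMeasurableFun.Build _ _ _ _ (rv_scale Y U) (measurable_rv_scale Y U).

End vector_random_variables.

(* Main.v *)
(* Write w(u) = prod_j u_j^(a_j - 1) for u with positive coordinates, and 0
   otherwise; on the simplex the Dirichlet density is a multiple of w. Given
   Y = y and B = e_i, the point z = (1 - y) x + y e_i is an affine image of x,
   and the Jacobian (1 - y)^d together with the beta density, proportional to
   (1 - y)^(a - 1), exactly compensates the homogeneity of w: the joint density
   of (y, z) is proportional to w(z - y e_i). Integrating y over (0, 1) gives
   (z_i / a_i) w(z), and the mixture with weights a_i / a gives
   (sum_i z_i) w(z) / a = w(z) / a. The remaining constant is 1 because both
   sides are probability measures, so no value of Gamma is ever needed. *)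
From HB Require Import structures.
Require Import Defs.
From mathcomp Require Import all_boot all_order all_algebra.
From mathcomp Require Import all_classical all_reals all_analysis.
From mathcomp Require Import measurable_realfun.
From mathcomp Require Import ring lra.

Set Implicit Arguments.
Unset Strict Implicit.
Unset Printing Implicit Defensive.
Import Order.TTheory GRing.Theory Num.Theory.
Import numFieldNormedType.Exports.

Local Open Scope classical_set_scope.
Local Open Scope ring_scope.

(** * Affine changes of variables *)

Section affine_substitution.
Variable R : realType.
Local Notation mu := (@lebesgue_measure R).

Lemma measurable_affine (s c : R) :
  measurable_fun [set: measurableTypeR R]
    (fun x => s * x + c : measurableTypeR R).
Proof. by apply: measurable_funD => //; apply: measurable_funM. Qed.

(** The left side, as a function of [A], is a rescaled image measure that gives every half-open
    interval its length; Lebesgue measure is the only measure that does so. *)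
Lemma lebesgue_measure_affine (s c : R) (A : set R) : 0 < s -> measurable A ->
  (s%:E * mu ((fun x : R => s * x + c)%R @^-1` A))%E = mu A.
Proof.
move=> s0 mA.
pose m := measure_function_pushforward__canonical__measure_function_Measure
    mu (measurable_affine s c).
pose m' := mscale (NngNum (ltW s0)) m.
transitivity (m' A) => //.
apply/esym/lebesgue_measure_unique => // _ [[x y]] _ <-.
change (mu `]x, y] = s%:E * mu ((fun z : R => s * z + c)%R @^-1` `]x, y]))%E.
rewrite (_ : _ @^-1` _ = `](x - c) / s, (y - c) / s]%classic); last first.
  apply/seteqP; split => z /=; rewrite !in_itv /=;
    by rewrite ltr_pdivrMr // ler_pdivlMr // ltrBlDr lerBrDr mulrC.
rewrite !lebesgue_measure_itv /= !lte_fin ltr_pM2r ?invr_gt0 // ltrD2r.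
case: ifPn => _; last by rewrite mule0.
rewrite -!EFinD -EFinM; congr EFin.
by field; rewrite gt_eqF.
Qed.

Lemma ge0_integral_affine (s c : R) (f : R -> \bar R) : 0 < s ->
  measurable_fun setT f -> (forall x, 0 <= f x)%E ->
  (s%:E * \int[mu]_x f (s * x + c)%R = \int[mu]_x f x)%E.
Proof.
move=> s0 mf f0.
pose m := measure_function_pushforward__canonical__measure_function_Measure
    mu (measurable_affine s c).
transitivity (\int[mscale (NngNum (ltW s0)) m]_x f x)%E.
  rewrite ge0_integral_mscale //=; congr (_ * _)%E.
  by rewrite (ge0_integral_pushforward (measurable_affine s c)).
apply: eq_measure_integral => A mA _ /=.
by rewrite /mscale /= /pushforward lebesgue_measure_affine.
Qed.

End affine_substitution.

Section tuple_affine.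
Variable R : realType.

Definition tuple_affine n (s : R) (c x : n.-tuple R) : n.-tuple R :=
  [tuple s * tnth x i + tnth c i | i < n].

Lemma measurable_tuple_affine n s c :
  measurable_fun setT (@tuple_affine n s c).
Proof.
apply/measurable_fun_tnthP => i.
rewrite (_ : _ \o _ = (fun w => s * tnth w i + tnth c i)); last first.
  by apply/funext => w /=; rewrite tnth_mktuple.
apply: measurable_funD => //; apply: measurable_funM => //.
exact: measurable_tnth.
Qed.

Lemma measurable_fun_lebesgue_cons n (f : n.+1.-tuple R -> \bar R) :
  measurable_fun setT f -> (forall x, 0 <= f x)%E ->
  measurable_fun [set: measurableTypeR R]
    (fun t => \int[lebesgue_tuple R n]_x f (tuple_cons (t, x)))%E.
Proof.
move=> mf f0.
apply: (measurable_fun_fubini_tonelli_F (f \o @tuple_cons R n)) => [|p].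
  exact: measurableT_comp mf (@measurable_tuple_cons R n).
exact: f0.
Qed.

(** Tonelli's theorem: the measure in dimension [n.+1] is by construction the image under
    [tuple_cons] of a product with Lebesgue measure. *)
Lemma ge0_integral_lebesgue_cons n (f : n.+1.-tuple R -> \bar R) :
  measurable_fun setT f -> (forall x, 0 <= f x)%E ->
  (\int[lebesgue_tuple R n.+1]_x f x = \int[@lebesgue_measure R]_t
     \int[lebesgue_tuple R n]_x f (tuple_cons (t, x)))%E.
Proof.
move=> mf f0.
rewrite (ge0_integral_pushforward (@measurable_tuple_cons R n)) //.
rewrite preimage_setT fubini_tonelli1 //.
  exact: measurableT_comp mf (@measurable_tuple_cons R n).
by move=> p; exact: f0.
Qed.

(** Induction on the dimension: the map acts on the head and on the tail separately, so each
    coordinate contributes one factor [s] by the one-dimensional formula. *)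
Lemma ge0_integral_tuple_affine n (s : R) (c : n.-tuple R)
    (f : n.-tuple R -> \bar R) : 0 < s ->
  measurable_fun setT f -> (forall x, 0 <= f x)%E ->
  ((s ^+ n)%:E * \int[lebesgue_tuple R n]_x f (tuple_affine s c x) =
   \int[lebesgue_tuple R n]_x f x)%E.
Proof.
move=> s0; elim: n c f => [|n IH] c f mf f0.
  rewrite expr0 mul1e; apply: eq_integral => x _; congr f.
  by rewrite [RHS]tuple0 [LHS]tuple0.
have mfs : measurable_fun setT (f \o @tuple_affine n.+1 s c).
  exact: measurableT_comp mf (measurable_tuple_affine _ _).
rewrite !ge0_integral_lebesgue_cons //.
pose c' : n.-tuple R := [tuple of behead c].
have E t x : tuple_affine s c (tuple_cons (t, x)) =
    tuple_cons (s * t + thead c, tuple_affine s c' x).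
  apply: eq_from_tnth => i; rewrite tnth_mktuple.
  case: (unliftP ord0 i) => [j|] ->; last by [].
  rewrite !tnthS tnth_mktuple tnth_behead; congr (_ + tnth c _).
  (* [tnth_behead] yields the index [inord j.+1], which has the same value as [lift ord0 j]. *)
  by apply/val_inj; rewrite /= inordK // ltnS.
rewrite exprS EFinM -muleA -ge0_integralZl //=; last 3 first.
- by apply: (measurable_fun_lebesgue_cons mfs) => x; exact: f0.
- by move=> t _; exact: integral_ge0.
- by rewrite lee_fin exprn_ge0 // ltW.
rewrite -[RHS](ge0_integral_affine (thead c) s0); last 2 first.
- exact: (measurable_fun_lebesgue_cons mf f0).
- by move=> t; exact: integral_ge0.
congr (_ * _)%E; apply: eq_integral => t _.
rewrite -[RHS](IH c') //.
  by congr (_ * _)%E; apply: eq_integral => x _; rewrite E.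
apply: (measurableT_comp mf).
apply: (measurableT_comp (@measurable_tuple_cons R n)).
exact: measurable_pair1.
Qed.

End tuple_affine.

(** * Joint laws *)

Section density_measure.
Local Open Scope ereal_scope.
Context d (T : measurableType d) (R : realType).
Variables (mu : {measure set T -> \bar R}) (f : T -> \bar R).
Hypothesis mf : measurable_fun setT f.
Hypothesis f0 : forall x, 0 <= f x.

Let nu (A : set T) : \bar R := \int[mu]_(x in A) f x.

Let nu0 : nu set0 = 0. Proof. exact: integral_set0. Qed.

Let nu_ge0 A : 0 <= nu A. Proof. exact: integral_ge0. Qed.

Let nu_sigma_additive : semi_sigma_additive nu.
Proof.
move=> F mF tF mUF; rewrite /nu ge0_integral_bigcup //; last first.
  exact: measurable_funTS.
apply: cvg_toP => //; apply: ereal_nondecreasing_is_cvgn => m n mn.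
by apply: lee_sum_nneg_natr => // k _ _; exact: integral_ge0.
Qed.

(** Packs the set function with density [f] as a measure, so that its images can be compared with
    product measures by uniqueness. *)
Lemma density_measure :
  {nu : {measure set T -> \bar R} | forall A, nu A = \int[mu]_(x in A) f x}.
Proof.
pose m : {measure set T -> \bar R} :=
  HB.pack nu (isMeasure.Build _ _ _ nu nu0 nu_ge0 nu_sigma_additive).
by exists m.
Qed.

End density_measure.

Section joint_law.
Local Open Scope ereal_scope.
Context d d1 d2 d3 (T : measurableType d) (T1 : measurableType d1)
  (T2 : measurableType d2) (S : measurableType d3) (R : realType).
Variable P : probability T R.
Variables (Y : {RV P >-> T1}) (X : {RV P >-> T2}).

(** Taking full sets in the product rule shows that [c] is the probability of [E]. The claim is
    that, conditionally on [E], the pair has the product law; the rule on rectangles determines this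
    law. *)
Lemma independent_on_joint_law (E : set T) (c : R) (C : set (T1 * T2)) :
  (0 < c)%R -> measurable E ->
  (forall A B, measurable A -> measurable B ->
    P (Y @^-1` A `&` X @^-1` B `&` E) = P (Y @^-1` A) * P (X @^-1` B) * c%:E) ->
  measurable C ->
  P ([set w | C (Y w, X w)] `&` E) =
  c%:E * (distribution P Y \x distribution P X) C.
Proof.
move=> c0 mE indep mC.
have mYX : measurable_fun setT (fun w => (Y w, X w)).
  by apply/measurable_fun_pair; exact: measurable_funPT.
have ci0 : (0 <= c^-1)%R by rewrite invr_ge0 ltW.
(* The joint law of [Y] and [X] restricted to [E] and divided by [c], that is, the conditional law
   given [E]. *)
pose m : {measure set (T1 * T2) -> \bar R} := mscale (NngNum ci0)
  (measure_function_pushforward__canonical__measure_function_Measure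
    (mrestr P mE) mYX).
have mD D : m D = (c^-1)%:E * P ([set w | D (Y w, X w)] `&` E) by [].
rewrite (product_measure_unique (m' := m)) // => [|A B mA mB].
  by rewrite mD muleA -EFinM mulfV ?gt_eqF // mul1e.
rewrite mD; have /= -> := indep _ _ mA mB.
by rewrite muleC -muleA -EFinM mulfV ?gt_eqF // mule1.
Qed.

Variables (mu1 : {sigma_finite_measure set T1 -> \bar R}).
Variables (mu2 : {sigma_finite_measure set S -> \bar R}).
Variables (g : T1 -> \bar R) (f : S -> \bar R) (s : S -> T2).
Hypotheses (mg : measurable_fun setT g) (g0 : forall y, 0 <= g y).
Hypotheses (mf : measurable_fun setT f) (f0 : forall x, 0 <= f x).
Hypothesis ms : measurable_fun setT s.

(** The law of [X] is only the image under [s] of a law with a density: a Dirichlet law sits on a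
    hyperplane and has its density in the [d] free coordinates. The measure with density
    [g y * f x], carried over by [s], agrees with the product law on rectangles, hence
    everywhere. *)
Lemma product_law_density (C : set (T1 * T2)) :
  has_law Y (fun A => \int[mu1]_(y in A) g y) ->
  has_law X (fun A => \int[mu2]_(x in s @^-1` A) f x) ->
  measurable C ->
  (distribution P Y \x distribution P X) C =
  \int[mu1]_y \int[mu2]_x (g y * f x * (\1_C (y, s x))%:E).
Proof.
move=> lY lX mC.
have mgf : measurable_fun setT (fun p : T1 * S => g p.1 * f p.2).
  by apply: emeasurable_funM; exact: measurableT_comp.
have mis : measurable_fun setT (fun p : T1 * S => (p.1, s p.2)).
  by apply/measurable_fun_pair => //; exact: measurableT_comp.
have [nu nuE] := @density_measure _ _ R (mu1 \x mu2) _ mgf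
  (fun p => mule_ge0 (g0 p.1) (f0 p.2)).
pose m := measure_function_pushforward__canonical__measure_function_Measure
  nu mis.
have mE D : measurable D -> m D =
    \int[mu1]_y \int[mu2]_x (g y * f x * (\1_D (y, s x))%:E).
  move=> mD; rewrite /m /= /pushforward nuE integral_mkcond.
  rewrite -(fubini_tonelli1 (fun p : T1 * S =>
    g p.1 * f p.2 * (\1_D (p.1, s p.2))%:E)).
  - apply: eq_integral => p _.
    by rewrite epatch_indic /= !indicE.
  - apply: emeasurable_funM => //; apply/measurable_EFinP.
    exact: (measurableT_comp (measurable_indic mD) mis).
  - by move=> p; rewrite !mule_ge0 // lee_fin.
rewrite -mE //; apply: product_measure_unique => // A B mA mB.
rewrite mE; last exact: measurableX.
transitivity ((\int[mu1]_(y in A) g y) *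
    (\int[mu2]_(x in s @^-1` B) f x)); last first.
  by congr (_ * _); [exact: esym (lY A mA)|exact: esym (lX B mB)].
(* On a rectangle the indicator is a product, so the double integral splits into two factors. *)
rewrite [X in _ = X * _]integral_mkcond [X in _ = _ * X]integral_mkcond.
have mgA : measurable_fun setT (g \_ A).
  by apply/(measurable_restrictT _ mA); exact: measurable_funTS.
have msB : measurable (s @^-1` B).
  by rewrite -[X in measurable X]setTI; exact: ms.
have mfB : measurable_fun setT (f \_ (s @^-1` B)).
  by apply/(measurable_restrictT _ msB); exact: measurable_funTS.
have gA0 y : 0 <= (g \_ A) y by exact: erestrict_ge0.
have fB0 x : 0 <= (f \_ (s @^-1` B)) x by exact: erestrict_ge0.
rewrite -ge0_integralZr //; last exact: integral_ge0.
apply: eq_integral => y _; rewrite -ge0_integralZl //.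
apply: eq_integral => x _.
rewrite !epatch_indic /= !indicE in_setX muleACA -EFinM -natrM mulnb.
by congr (_ * (_ (_ && _))%:R%:E); rewrite inE.
Qed.

End joint_law.

(** * Dirichlet weights *)

Section pospow.
Variable R : realType.
Local Notation mu := (@lebesgue_measure R).

(* With the value 0 for t <= 0, a product of such factors encodes the support of
   a Dirichlet density. *)
Definition pospow (s t : R) : R := if 0 < t then t `^ (s - 1) else 0.

Lemma pospow_ge0 s t : 0 <= pospow s t.
Proof. by rewrite /pospow; case: ifP => // _; exact: powR_ge0. Qed.

Lemma measurable_pospow s : measurable_fun setT (pospow s).
Proof. by apply: measurable_fun_ifT => //; exact: measurable_fun_ltr. Qed.

Lemma pospowM s t u : 0 < t -> pospow s (t * u) = t `^ (s - 1) * pospow s u.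
Proof.
move=> t0; rewrite /pospow pmulr_rgt0 //.
case: ifPn => [u0|_]; last by rewrite mulr0.
by rewrite powRM // ltW.
Qed.

Lemma is_derive_powR_sub (r u y : R) : y < u ->
  is_derive y 1 (fun x => (u - x) `^ r) (- (r * (u - y) `^ (r - 1))).
Proof.
move=> yu.
have d1 : is_derive (u - y) 1 (fun x : R => x `^ r) (r * (u - y) `^ (r - 1)).
  by apply: is_derive1_powR; rewrite subr_gt0.
have d2 : is_derive y 1 (fun x : R => u - x) (-1).
  by apply: is_derive_eq; rewrite add0r mul1r.
rewrite -[- (_ * _)]mulrN1.
exact: (@is_derive1_comp R (fun x : R => x `^ r) (fun x : R => u - x)
  _ _ _ d1 d2).
Qed.

Lemma continuous_powR_sub (r u y : R) : y < u ->
  {for y, continuous (fun x => (u - x) `^ r)}.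
Proof.
move=> yu; apply/differentiable_continuous/derivable1_diffP.
exact: (@ex_derive _ _ _ _ _ _ _ (is_derive_powR_sub r yu)).
Qed.

(** For [s < 1] the integrand is unbounded near [u], so the fundamental theorem of calculus is
    applied only up to [u - v]. *)
Lemma integral_powR_sub_cc (s u v : R) : 0 < s -> 0 < v < u ->
  (\int[mu]_(y in `[0%R, (u - v)%R]) ((u - y) `^ (s - 1))%:E =
   ((u `^ s - v `^ s) / s)%:E)%E.
Proof.
move=> s0 /andP[v0 vu].
pose F y := - s^-1 * (u - y) `^ s.
have dF y : y < u -> is_derive y 1 F ((u - y) `^ (s - 1)).
  move=> yu; have d := is_derive_powR_sub s yu.
  have := is_deriveZ (- s^-1) d.
  move=> d'; apply: (@is_derive_eq _ _ _ _ _ _ _ _ d').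
  by rewrite scalerN scaleNr opprK /GRing.scale /= mulrA mulVf ?mul1r // gt_eqF.
have cF y : y < u -> {for y, continuous F}.
  move=> yu; apply/differentiable_continuous/derivable1_diffP.
  exact: (@ex_derive _ _ _ _ _ _ _ (dF _ yu)).
have uvu : u - v < u by rewrite ltrBlDr ltrDl.
rewrite (@continuous_FTC2 _ _ F) ?subr_gt0 //; last 3 first.
- apply: continuous_in_subspaceT => y; rewrite inE /= in_itv /= => /andP[_ yv].
  by apply: continuous_powR_sub; exact: le_lt_trans yv uvu.
- split.
  + move=> y; rewrite in_itv /= => /andP[_ yv].
    exact: (@ex_derive _ _ _ _ _ _ _ (dF _ (lt_trans yv uvu))).
  + by apply: cvg_at_right_filter; apply: cF; exact: lt_trans vu.
  + by apply: cvg_at_left_filter; apply: cF.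
- move=> y; rewrite in_itv /= => /andP[_ yv].
  by rewrite derive1E (@derive_val _ _ _ _ _ _ _ (dF _ (lt_trans yv uvu))).
rewrite -EFinB /F subr0 subKr; congr EFin.
by field; rewrite gt_eqF.
Qed.

(** Monotone convergence along the intervals from 0 to [u - v n], where [v n] decreases to 0. *)
Lemma integral_powR_sub (s u : R) : 0 < s -> 0 < u ->
  (\int[mu]_(y in `]0%R, u[) ((u - y) `^ (s - 1))%:E = (u `^ s / s)%:E)%E.
Proof.
move=> s0 u0.
have mf (D : set R) : measurable_fun D (fun y => ((u - y) `^ (s - 1))%:E).
  apply/measurable_funTS/measurable_EFinP.
  exact: (measurableT_comp (measurable_powR _) (measurable_funB _ _)).
rewrite integral_itv_obnd_cbnd; last exact: mf.
(* [harmonic 0] is 1, so the factor 1/2 keeps [v n] strictly below [u] from the first term on. *)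
pose v n : R := u / 2 * harmonic n.
have u20 : 0 < u / 2 by rewrite divr_gt0.
have v0 n : 0 < v n < u.
  rewrite mulr_gt0 //= (@le_lt_trans _ _ (u / 2)) //; last by lra.
  by rewrite ler_piMr ?(ltW u20) // /harmonic /= invf_le1 ?ler1n.
have v_cvg : v n @[n --> \oo] --> (0 : R).
  by rewrite -(mulr0 (u / 2)); apply: cvgMr; exact: cvg_harmonic.
pose D n := `[0, u - v n]%classic.
have DE : `[0, u[%classic = \bigcup_n D n.
  apply/seteqP; split => y /=; rewrite in_itv /=.
    move=> /andP[y0 yu]; have uy : 0 < u - y by rewrite subr_gt0.
    have [N _ /(_ N (leqnn N)) vN] := cvgr_lt _ v_cvg _ uy.
    by exists N => //; rewrite /D /= in_itv /= y0 lerBrDl -lerBrDr ltW.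
  move=> [n _]; rewrite /D /= in_itv /= => /andP[-> yn] /=.
  by rewrite (le_lt_trans yn) // ltrBlDr ltrDl; case/andP: (v0 n).
have ID n : (\int[mu]_(y in D n) ((u - y) `^ (s - 1))%:E =
    ((u `^ s - v n `^ s) / s)%:E)%E by exact: integral_powR_sub_cc.
have cvgD : (((u `^ s - v n `^ s) / s)%:E @[n --> \oo] -->
    \int[mu]_(y in \bigcup_n D n) ((u - y) `^ (s - 1))%:E)%E.
  under eq_fun do rewrite -ID.
  apply: ge0_nondecreasing_set_cvg_integral => //.
  - move=> n m nm; apply/subsetPset => y; rewrite /D /= !in_itv /=.
    move=> /andP[-> /le_trans]; apply; rewrite lerB // ler_pM2l //.
    by rewrite lef_pV2 ?posrE // ler_nat.
  - by move=> n; exact: measurable_itv.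
  - by move=> n; exact: mf.
  - by move=> n y _; rewrite lee_fin powR_ge0.
transitivity (\int[mu]_(y in \bigcup_n D n) ((u - y) `^ (s - 1))%:E)%E.
  by rewrite -DE.
rewrite -(cvg_lim _ cvgD) //; apply/cvg_lim => //.
apply: cvg_EFin; first by near=> n.
have c0 : v n `^ s @[n --> \oo] --> (0 : R).
  have /cvg_at_rightP := @powR_cvg0 R s s0; apply; split => // n.
  by case/andP: (v0 n).
have c1 : (u `^ s - v n `^ s) / s @[n --> \oo] --> (u `^ s - 0) / s.
  by apply: cvgMl; exact: cvgB (cvg_cst _) c0.
by rewrite subr0 in c1.
Unshelve. all: by end_near. Qed.

(** The factor [pospow] cuts the integral off at [u], which lies within the range of integration
    when [0 < u <= 1]. Writing the value as a multiple of [pospow s u] instead of a power of [u]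
    covers [u <= 0], where both sides vanish, and makes the original weight reappear. *)
Lemma integral_pospow_sub (s u : R) : 0 < s -> u <= 1 ->
  (\int[mu]_(y in `]0%R, 1%R[) (pospow s (u - y))%:E =
   (u / s * pospow s u)%:E)%E.
Proof.
move=> s0 u1; rewrite {2}/pospow; case: ifPn => u0; last first.
  rewrite mulr0 integral0_eq // => y; rewrite /= in_itv /= => /andP[y0 _].
  rewrite /pospow ifF //; apply/negbTE; rewrite -leNgt subr_le0.
  by rewrite (le_trans _ (ltW y0)) // leNgt.
rewrite (_ : u / s * _ = u `^ s / s); last first.
  rewrite mulrAC; congr (_ / _).
  have us : u `^ (1 + (s - 1)) = u `^ 1 * u `^ (s - 1).
    by apply: powRD; apply/implyP => _; rewrite gt_eqF.
  by rewrite -[in RHS](subrKC 1 s) us powRr1 // ltW.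
rewrite -integral_powR_sub // integral_mkcond [RHS]integral_mkcond.
apply: eq_integral => y _.
rewrite !patchE /pospow !mem_setE !in_itv /= subr_gt0.
case: (ltP 0 y) => //= y0; case: (ltP y u) => [yu|_]; last by case: ifP.
by rewrite (lt_le_trans yu).
Qed.

End pospow.

Lemma powR_sum (R : realType) (I : Type) (r : seq I) (x : R) (f : I -> R) :
  0 < x -> x `^ (\sum_(i <- r) f i) = \prod_(i <- r) x `^ (f i).
Proof.
move=> x0; elim/big_rec2: _ => [|i p t _ <-]; first exact: powRr0.
by apply: powRD; apply/implyP => _; rewrite gt_eqF.
Qed.

Section simplex_weight.
Variables (R : realType) (n : nat) (a : 'I_n -> R).
Local Notation mu := (@lebesgue_measure R).

Definition simplex_weight (u : n.-tuple R) : R :=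
  \prod_(j < n) pospow (a j) (tnth u j).

Definition toward_vertex (i : 'I_n) (y : R) (u : n.-tuple R) : n.-tuple R :=
  [tuple (1 - y) * tnth u j + y * (i == j)%:R | j < n].

Definition minus_vertex (i : 'I_n) (y : R) (u : n.-tuple R) : n.-tuple R :=
  [tuple tnth u j - y * (i == j)%:R | j < n].

Lemma simplex_weight_ge0 u : 0 <= simplex_weight u.
Proof. by apply: prodr_ge0 => j _; exact: pospow_ge0. Qed.

(** A coordinate may be negative, but then the weight is zero. *)
Lemma simplex_weight_tnth_ge0 i u : 0 <= tnth u i * simplex_weight u.
Proof.
case: (ltP 0 (tnth u i)) => [u0|u0].
  by rewrite mulr_ge0 ?simplex_weight_ge0 ?ltW.
by rewrite /simplex_weight (bigD1 i) //= {1}/pospow ltNge u0 mul0r mulr0.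
Qed.

Lemma measurable_simplex_weight : measurable_fun setT simplex_weight.
Proof.
apply: measurable_prod => j _.
exact: measurableT_comp (measurable_pospow _) (measurable_tnth j).
Qed.

(** Removing the vertex part leaves [(1 - y) u], and factor [j] is homogeneous of degree [a j - 1].
    The [n] missing units of degree are put on the right as a natural power. *)
Lemma simplex_weight_toward_vertex i (y : R) u : y < 1 ->
  (1 - y) `^ (\sum_(j < n) a j) * simplex_weight u =
  (1 - y) ^+ n * simplex_weight (minus_vertex i y (toward_vertex i y u)).
Proof.
rewrite -subr_gt0 => y1.
have -> : simplex_weight (minus_vertex i y (toward_vertex i y u)) =
    \prod_(j < n) ((1 - y) `^ (a j - 1) * pospow (a j) (tnth u j)).
  by apply: eq_bigr => j _; rewrite !tnth_mktuple addrK pospowM.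
rewrite big_split /= mulrA; congr (_ * _).
rewrite -[n in _ ^+ n]card_ord -prodr_const -big_split /= powR_sum //.
apply: eq_bigr => j _.
have := @powRD _ (1 - y) 1 (a j - 1); rewrite subrKC => ->.
  by rewrite powRr1 // ltW.
by apply/implyP => _; rewrite gt_eqF.
Qed.

(** Only coordinate [i] depends on [y], so the other factors come out as a constant [p] and a
    one-dimensional integral remains. *)
Lemma integral_simplex_weight_minus_vertex i (u : n.-tuple R) :
  0 < a i -> \sum_(j < n) tnth u j <= 1 ->
  (\int[mu]_(y in `]0%R, 1%R[) (simplex_weight (minus_vertex i y u))%:E =
   (tnth u i / a i * simplex_weight u)%:E)%E.
Proof.
move=> ai0 u1.
pose p := \prod_(j < n | j != i) pospow (a j) (tnth u j).
have p0 : 0 <= p by apply: prodr_ge0 => j _; exact: pospow_ge0.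
have wE y : simplex_weight (minus_vertex i y u) =
    p * pospow (a i) (tnth u i - y).
  rewrite /simplex_weight (bigD1 i) //= tnth_mktuple eqxx mulr1 mulrC.
  congr (_ * _); apply: eq_bigr => j ji.
  by rewrite tnth_mktuple eq_sym (negbTE ji) mulr0 subr0.
have -> : simplex_weight u = p * pospow (a i) (tnth u i).
  by rewrite /simplex_weight (bigD1 i) //= mulrC.
under eq_integral do rewrite wE EFinM.
rewrite ge0_integralZl //=; last 2 first.
- apply/measurable_funTS/measurable_EFinP.
  exact: (measurableT_comp (measurable_pospow _) (measurable_funB _ _)).
- by move=> y _; rewrite lee_fin pospow_ge0.
(* If [p] is 0, both sides vanish. Otherwise all other coordinates are positive, and the bound on
   the sum gives [tnth u i <= 1], as the one-dimensional integral requires. *)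
have [->|pn0] := eqVneq p 0; first by rewrite mul0e mul0r mulr0.
rewrite integral_pospow_sub //; first by rewrite -EFinM mulrCA.
rewrite (le_trans _ u1) // (bigD1 i) //= lerDl; apply: sumr_ge0 => j ji.
rewrite leNgt; apply: contraNN pn0 => uj.
by rewrite /p (bigD1 j) //= {1}/pospow ltNge ltW // mul0r.
Qed.

End simplex_weight.

Section dirichlet_density.
Variables (R : realType) (d : nat) (a : 'I_d.+1 -> R).

Definition dirichlet_const : R :=
  Gamma (\sum_(i < d.+1) a i) / (\prod_(i < d.+1) Gamma (a i)).

Lemma tnth_simplex_point0 (x : d.-tuple R) :
  tnth (simplex_point x) ord0 = 1 - \sum_(i < d) tnth x i.
Proof. exact: tnth0. Qed.

Lemma tnth_simplex_pointS (x : d.-tuple R) i :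
  tnth (simplex_point x) (lift ord0 i) = tnth x i.
Proof. exact: tnthS. Qed.

Lemma Gamma_ge0 (s : R) : 0 <= Gamma s.
Proof.
by apply: Rintegral_ge0 => x _; rewrite mulr_ge0 ?powR_ge0 ?expR_ge0.
Qed.

Lemma dirichlet_const_ge0 : 0 <= dirichlet_const.
Proof.
by rewrite divr_ge0 ?Gamma_ge0 // prodr_ge0 // => i _; exact: Gamma_ge0.
Qed.

(** The condition that the coordinates sum to less than 1 is the positivity of coordinate 0 of the
    simplex point, so the vanishing of [pospow] encodes the whole support. *)
Lemma dirichlet_densityE x :
  dirichlet_density a x = dirichlet_const * simplex_weight a (simplex_point x).
Proof.
rewrite /simplex_weight big_ord_recl.
under eq_bigr do rewrite tnth_simplex_pointS.
rewrite tnth_simplex_point0 /dirichlet_density {1}/pospow subr_gt0.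
case: ifPn => [/andP[/forallP x0 ->]|].
  rewrite -mulrA; congr (_ * (_ * _)); apply: eq_bigr => i _.
  by rewrite /pospow x0.
rewrite negb_and => /orP[|/negbTE ->]; last by rewrite mul0r mulr0.
move=> /forallPn[i xi].
have -> : \prod_(j < d) pospow (a (lift ord0 j)) (tnth x j) = 0.
  by rewrite (bigD1 i) //= /pospow (negbTE xi) mul0r.
by rewrite !mulr0.
Qed.

Lemma sum_simplex_point (x : d.-tuple R) : \sum_j tnth (simplex_point x) j = 1.
Proof.
rewrite big_ord_recl; under eq_bigr do rewrite tnth_simplex_pointS.
by rewrite tnth_simplex_point0 subrK.
Qed.

Lemma measurable_simplex_point : measurable_fun setT (@simplex_point R d).
Proof.
apply/measurable_cons => //; apply: measurable_funB => //.
by apply: measurable_sum => i; exact: measurable_tnth.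
Qed.

(** Moving toward a vertex preserves the coordinate sum 1, so in the [d] free coordinates it is an
    affine map to which the substitution formula applies, and coordinate 0 follows. *)
Lemma simplex_point_tuple_affine i y (x : d.-tuple R) :
  simplex_point (tuple_affine (1 - y)
    [tuple y * (i == lift ord0 j)%:R | j < d] x) =
  toward_vertex i y (simplex_point x).
Proof.
apply: eq_from_tnth => k; rewrite tnth_mktuple.
case: (unliftP ord0 k) => [j|] ->.
  by rewrite !tnth_simplex_pointS !tnth_mktuple.
rewrite !tnth_simplex_point0.
under eq_bigr do rewrite !tnth_mktuple.
rewrite big_split /= -!mulr_sumr.
(* The shift omits coordinate 0 of the vertex, so these entries sum to 0 when [i] is [ord0] and to 1
   otherwise. *)
have -> : \sum_(j < d) (i == lift ord0 j)%:R = 1 - (i == ord0)%:R :> R.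
  case: (unliftP ord0 i) => [k'|] ->.
    rewrite (bigD1 k') //= eqxx big1 ?addr0 ?subr0 // => j jk.
    by rewrite (inj_eq lift_inj) eq_sym (negbTE jk).
  by rewrite eqxx subrr big1 // => j _; rewrite (negbTE (neq_lift _ _)).
ring.
Qed.

End dirichlet_density.

(** * Mixing with a vertex *)

Section beta_dirichlet.
Variables (R : realType) (d : nat) (a : 'I_d.+1 -> R).
Hypothesis a0 : forall i, 0 < a i.
Local Notation mu := (@lebesgue_measure R).
Local Notation s := (\sum_(i < d.+1) a i).

Definition beta_const (p q : R) : R := Gamma (p + q) / (Gamma p * Gamma q).

Lemma beta_const_ge0 p q : 0 <= beta_const p q.
Proof. by rewrite divr_ge0 ?mulr_ge0 ?Gamma_ge0. Qed.

Lemma beta_density1E (q y : R) :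
  beta_density 1 q y = \1_(`]0, 1[) y * (beta_const 1 q * (1 - y) `^ (q - 1)).
Proof.
rewrite /beta_density indicE mem_setE in_itv /=.
by case: ifP => _; rewrite ?mul0r ?mul1r // subrr powRr0 mulr1.
Qed.

Lemma beta_density1_ge0 (q y : R) : 0 <= beta_density 1 q y.
Proof.
rewrite beta_density1E indicE mulr_ge0 ?ler0n //.
by rewrite mulr_ge0 ?beta_const_ge0 ?powR_ge0.
Qed.

Lemma measurable_beta_density1 (q : R) :
  measurable_fun setT (beta_density 1 q).
Proof.
rewrite (funext (beta_density1E q)).
apply: measurable_funM => //; apply: measurable_funM => //.
exact: (measurableT_comp (measurable_powR _) (measurable_funB _ _)).
Qed.

Lemma dirichlet_density_ge0 x : 0 <= dirichlet_density a x.
Proof.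
by rewrite dirichlet_densityE mulr_ge0 ?dirichlet_const_ge0 ?simplex_weight_ge0.
Qed.

Lemma measurable_dirichlet_density :
  measurable_fun setT (@dirichlet_density R d a).
Proof.
rewrite (funext (dirichlet_densityE a)).
apply: measurable_funM => //.
exact: measurableT_comp (measurable_simplex_weight _)
  (@measurable_simplex_point R d).
Qed.

Section vertex.
Variables (i : 'I_d.+1) (A : set (d.+1.-tuple R)).
Hypothesis mA : measurable A.

(* The joint density of (y, z) in the header, for B = e_i, cut to z in A. *)
Definition shifted_density (y : measurableTypeR R) (x : d.-tuple R) : R :=
  \1_(`]0, 1[) y * (beta_const 1 s * (dirichlet_const a *
    simplex_weight a (minus_vertex i y (simplex_point x)))) *
  \1_A (simplex_point x).

Lemma shifted_density_ge0 y x : 0 <= shifted_density y x.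
Proof.
rewrite /shifted_density !indicE mulr_ge0 ?ler0n // mulr_ge0 ?ler0n //.
rewrite mulr_ge0 ?beta_const_ge0 //.
by rewrite mulr_ge0 ?dirichlet_const_ge0 ?simplex_weight_ge0.
Qed.

Lemma measurable_shifted_density :
  measurable_fun setT
    (fun p : measurableTypeR R * d.-tuple R => shifted_density p.1 p.2).
Proof.
have m2 : measurable_fun setT
    (fun p : measurableTypeR R * d.-tuple R => simplex_point p.2).
  exact: measurableT_comp (@measurable_simplex_point R d) measurable_snd.
apply: measurable_funM; last exact: measurableT_comp (measurable_indic mA) m2.
apply: measurable_funM.
  exact: (measurableT_comp (measurable_indic (measurable_itv `]0%R, 1%R[))
    measurable_fst).
do 2 (apply: measurable_funM => //).
apply: (measurableT_comp (measurable_simplex_weight _)).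
apply/measurable_fun_tnthP => j.
rewrite (_ : _ \o _ = fun p : measurableTypeR R * d.-tuple R =>
    tnth (simplex_point p.2) j - p.1 * (i == j)%:R); last first.
  by apply/funext => p /=; rewrite tnth_mktuple.
apply: measurable_funB; first exact: measurableT_comp (measurable_tnth j) m2.
by apply: measurable_funM => //; exact: measurable_fst.
Qed.

(** The substitution takes place in [d] coordinates while the weight has [d.+1] factors; the
    exponent [s - 1] of the beta density accounts for this difference of one. *)
Lemma integral_shifted_density_simplex y :
  (\int[lebesgue_tuple R d]_x
     ((beta_density 1 s y)%:E * (dirichlet_density a x)%:E *
      (\1_A (toward_vertex i y (simplex_point x)))%:E) =
   \int[lebesgue_tuple R d]_x (shifted_density y x)%:E)%E.
Proof.
have [y01|y01] := boolP (y \in `]0, 1[%classic); last first.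
  apply: eq_integral => x _.
  by rewrite beta_density1E /shifted_density indicE (negbTE y01) !mul0r !mul0e.
have y1 : y < 1 by move: y01; rewrite mem_setE in_itv /= => /andP[].
have y1' : 0 < 1 - y by rewrite subr_gt0.
pose c := [tuple y * (i == lift ord0 j)%:R | j < d].
(* The right side is pulled back along the map that moves [x] toward vertex [i]; the two integrands
   are then compared pointwise. *)
rewrite -[RHS](ge0_integral_tuple_affine c y1'); last 2 first.
- apply/measurable_EFinP.
  exact: (measurableT_comp measurable_shifted_density (measurable_pair1 y)).
- by move=> x; rewrite lee_fin shifted_density_ge0.
rewrite -ge0_integralZl //=; last 3 first.
- apply/measurable_EFinP.
  apply: (measurableT_comp _ (measurable_tuple_affine _ _)).
  exact: (measurableT_comp measurable_shifted_density (measurable_pair1 y)).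
- by move=> x _; rewrite lee_fin shifted_density_ge0.
- by rewrite lee_fin exprn_ge0 // ltW.
apply: eq_integral => x _; rewrite -!EFinM; congr EFin.
rewrite beta_density1E dirichlet_densityE /shifted_density indicE y01 !mul1r.
rewrite simplex_point_tuple_affine.
set w := simplex_weight _ _; set w' := simplex_weight _ _.
have E : (1 - y) `^ (s - 1) * w = (1 - y) ^+ d * w'.
  (* One more factor [1 - y] turns the exponents [s - 1] and [d] into the [s] and [d.+1] of the
     homogeneity lemma. *)
  apply: (mulfI (lt0r_neq0 y1')).
  rewrite !mulrA -exprS -(simplex_weight_toward_vertex a i _ y1); congr (_ * _).
  have := @powRD _ (1 - y) 1 (s - 1); rewrite subrKC => ->.
    by rewrite powRr1 // ltW.
  by apply/implyP => _; rewrite gt_eqF.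
move: (beta_const 1 s) (dirichlet_const a) (\1_A _) => K C b.
transitivity (K * C * ((1 - y) `^ (s - 1) * w) * b); first by ring.
by rewrite E; ring.
Qed.

Lemma integral_shifted_density_vertex x :
  (\int[mu]_y (shifted_density y x)%:E =
   (beta_const 1 s / a i *
    (tnth (simplex_point x) i * dirichlet_density a x *
     \1_A (simplex_point x)))%:E)%E.
Proof.
set u := simplex_point x.
have c0 : 0 <= beta_const 1 s * dirichlet_const a * \1_A u.
  rewrite indicE mulr_ge0 ?ler0n //.
  exact: mulr_ge0 (beta_const_ge0 1 s) (dirichlet_const_ge0 a).
transitivity (\int[mu]_(y in `]0%R, 1%R[)
    ((beta_const 1 s * dirichlet_const a * \1_A u)%:E *
     (simplex_weight a (minus_vertex i y u))%:E))%E.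
  rewrite [RHS]integral_mkcond epatch_indic.
  apply: eq_integral => y _ /=; rewrite -!EFinM; congr EFin.
  rewrite /shifted_density -/u.
  by move: (beta_const 1 s) (dirichlet_const a) => K C; ring.
rewrite ge0_integralZl //=; last 2 first.
- apply/measurable_funTS/measurable_EFinP.
  apply: (measurableT_comp (measurable_simplex_weight _)).
  apply/measurable_fun_tnthP => j.
  rewrite (_ : _ \o _ = fun y : R => tnth u j - y * (i == j)%:R); last first.
    by apply/funext => p /=; rewrite tnth_mktuple.
  by apply: measurable_funB => //; apply: measurable_funM.
- by move=> y _; rewrite lee_fin simplex_weight_ge0.
rewrite integral_simplex_weight_minus_vertex // ?sum_simplex_point //.
rewrite -EFinM; congr EFin; rewrite dirichlet_densityE -/u.
by move: (beta_const 1 s) (dirichlet_const a) => K C; ring.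
Qed.

Lemma vertex_density_ge0 x :
  0 <= tnth (simplex_point x) i * dirichlet_density a x *
       \1_A (simplex_point x).
Proof.
rewrite indicE mulr_ge0 ?ler0n // dirichlet_densityE mulrCA.
exact: mulr_ge0 (dirichlet_const_ge0 a) (simplex_weight_tnth_ge0 _ _ _).
Qed.

Lemma measurable_vertex_density : measurable_fun setT (fun x : d.-tuple R =>
  tnth (simplex_point x) i * dirichlet_density a x * \1_A (simplex_point x)).
Proof.
have ms := @measurable_simplex_point R d.
apply: measurable_funM; last exact: measurableT_comp (measurable_indic mA) ms.
apply: measurable_funM; last exact: measurable_dirichlet_density.
exact: measurableT_comp (measurable_tnth i) ms.
Qed.

(** The substitution is made with [y] fixed and the integration over [y] with the new point fixed,
    so Tonelli's theorem is used between the two. *)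
Lemma integral_beta_dirichlet_vertex :
  (\int[mu]_y \int[lebesgue_tuple R d]_x
     ((beta_density 1 s y)%:E * (dirichlet_density a x)%:E *
      (\1_A (toward_vertex i y (simplex_point x)))%:E) =
   (beta_const 1 s / a i)%:E * \int[lebesgue_tuple R d]_x
     (tnth (simplex_point x) i * dirichlet_density a x *
      \1_A (simplex_point x))%:E)%E.
Proof.
under eq_integral do rewrite integral_shifted_density_simplex.
rewrite (fubini_tonelli (fun p : measurableTypeR R * d.-tuple R =>
    (shifted_density p.1 p.2)%:E)) /=; last 2 first.
- by apply/measurable_EFinP; exact: measurable_shifted_density.
- by move=> p; rewrite lee_fin shifted_density_ge0.
under eq_integral do rewrite integral_shifted_density_vertex EFinM.
rewrite ge0_integralZl //=.
- by apply/measurable_EFinP; exact: measurable_vertex_density.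
- by move=> x _; rewrite lee_fin vertex_density_ge0.
- by rewrite lee_fin divr_ge0 ?beta_const_ge0 // ltW.
Qed.

End vertex.
End beta_dirichlet.

(** * Conditioning on the vertex *)

Lemma total_probability (disp : measure_display) (T : measurableType disp)
    (R : realType) (P : probability T R) (n : nat) (E : 'I_n -> set T)
    (F : set T) :
  (forall i, measurable (E i)) -> trivIset setT E ->
  (\sum_(i < n) P (E i) = 1)%E -> measurable F ->
  P F = (\sum_(i < n) P (F `&` E i))%E.
Proof.
move=> mE tE E1 mF.
have mU : measurable (\big[setU/set0]_(i < n) E i) by exact: bigsetU_measurable.
have PU : P (\big[setU/set0]_(i < n) E i) = 1%E.
  by rewrite measure_semi_additive_ord.
(* The disjoint events [E i] have total probability 1, so the part of [F] outside their union is a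
   null set. *)
rewrite (measureDI P mF mU) [X in (X + _)%E](_ : _ = 0%E) ?add0e; last first.
  apply: (@subset_measure0 _ _ _ P _ (~` \big[setU/set0]_(i < n) E i)) => //.
  - exact: measurableD.
  - exact: measurableC.
  - by apply: etrans (probability_setC P mU) _; rewrite PU subee.
rewrite big_distrr /= measure_semi_additive_ord //.
- by move=> i; exact: measurableI.
- exact: trivIset_setIl.
- by apply: bigsetU_measurable => i _; exact: measurableI.
Qed.

Lemma measurable_tuple_set1 (R : realType) n (v : n.-tuple R) :
  measurable [set v].
Proof.
rewrite (_ : [set v] = \bigcap_(i in [set: 'I_n])
    ((fun t : n.-tuple R => tnth t i) @^-1` [set tnth v i])).
  apply: fin_bigcap_measurable => // i _; rewrite -[X in measurable X]setTI.
  exact: measurable_tnth.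
apply/seteqP; split => [t /= -> //|t tv]; apply: eq_from_tnth => i; exact: tv.
Qed.

Lemma basis_vec_inj (R : realType) n : injective (@basis_vec R n).
Proof.
move=> i j /(congr1 (fun t => tnth t i)); rewrite !tnth_mktuple eqxx.
by have [->//|_] := eqVneq j i; move/eqP; rewrite oner_eq0.
Qed.

Lemma basis_law_set1 (R : realType) d (a : 'I_d.+1 -> R) i :
  basis_law a [set basis_vec R i] = (a i / \sum_(j < d.+1) a j)%:E.
Proof.
rewrite /basis_law; move: (\sum_(j < d.+1) a j) => s.
rewrite (bigD1 i) //= big1 ?adde0 => [|k ki].
  by rewrite diracE mem_set // mule1.
rewrite diracE memNset ?mule0 //= => /basis_vec_inj ik.
by rewrite ik eqxx in ki.
Qed.

Lemma measurable_toward_vertex (R : realType) n (i : 'I_n) :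
  measurable_fun setT
    (fun p : measurableTypeR R * n.-tuple R => toward_vertex i p.1 p.2).
Proof.
apply/measurable_fun_tnthP => j.
rewrite (_ : _ \o _ = fun p : measurableTypeR R * n.-tuple R =>
    (1 - p.1) * tnth p.2 j + p.1 * (i == j)%:R); last first.
  by apply/funext => p /=; rewrite tnth_mktuple.
have m1 : measurable_fun setT
    (fun p : measurableTypeR R * n.-tuple R => p.1 : R).
  exact: measurable_fst.
apply: measurable_funD; apply: measurable_funM => //.
  exact: measurable_funB.
exact: measurableT_comp (measurable_tnth j) measurable_snd.
Qed.

Lemma sum_ord_gt0 (R : realType) d (a : 'I_d.+1 -> R) :
  (forall i, 0 < a i) -> 0 < \sum_(i < d.+1) a i.
Proof.
by move=> a0; rewrite big_ord_recl ltr_pwDl // sumr_ge0 // => i _; exact: ltW.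
Qed.

(** The mixture weights cancel the denominators [a i], and the coordinates of a simplex point sum to
    1, so the vertex terms recombine into the Dirichlet law. *)
Lemma sum_vertex_integral (R : realType) d (a : 'I_d.+1 -> R) (K : R)
    (A : set (d.+1.-tuple R)) :
  (forall i, 0 < a i) -> measurable A -> 0 <= K ->
  (\sum_(i < d.+1) (a i / \sum_(j < d.+1) a j)%:E * ((K / a i)%:E *
     \int[lebesgue_tuple R d]_x
       (tnth (simplex_point x) i * dirichlet_density a x *
        \1_A (simplex_point x))%:E) =
   (K / \sum_(j < d.+1) a j)%:E * dirichlet_law a A)%E.
Proof.
move=> a0 mA K0.
have -> : dirichlet_law a A = (\sum_(i < d.+1) \int[lebesgue_tuple R d]_x
    (tnth (simplex_point x) i * dirichlet_density a x *
     \1_A (simplex_point x))%:E)%E.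
  rewrite -ge0_integral_sum //=.
  - rewrite /dirichlet_law integral_mkcond; apply: eq_integral => x _.
    rewrite epatch_indic /= sumEFin -!mulr_suml sum_simplex_point mul1r.
    by rewrite EFinM !indicE.
  - by move=> i; apply/measurable_EFinP; exact: measurable_vertex_density.
  - by move=> i x _; rewrite lee_fin vertex_density_ge0.
rewrite ge0_sume_distrr.
  apply: eq_bigr => i _; rewrite muleA -EFinM; congr (_%:E * _)%E.
  by field; rewrite !gt_eqF ?a0 ?sum_ord_gt0.
by move=> i _; apply: integral_ge0 => x _; rewrite lee_fin vertex_density_ge0.
Qed.

Theorem theorem1p1 (R : realType) (disp : measure_display)
    (T : measurableType disp) (P : probability T R) (d : nat)
    (a : 'I_d.+1 -> R)
    (X B : {RV P >-> d.+1.-tuple R}) (Y : {RV P >-> R}) :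
  (1 <= d)%N ->
  (forall i, 0 < a i) ->
  independent3 X Y B ->
  has_law X (dirichlet_law a) ->
  has_law Y (beta_law 1 (\sum_(i < d.+1) a i)) ->
  has_law B (basis_law a) ->
  eq_law X (rv_add (rv_scale (cst 1 \- Y) X) (rv_scale Y B)).
Proof.
move=> _ a0 indep lX lY lB.
(* Y' is Y seen in the copy of R that carries lebesgue_measure. *)
have mY : measurable_fun setT (Y : T -> measurableTypeR R) :=
  measurable_funPT Y.
pose Y' : {RV P >-> measurableTypeR R} := HB.pack (Y : T -> measurableTypeR R)
  (isMeasurableFun.Build _ _ _ _ (Y : T -> measurableTypeR R) mY).
set s := \sum_(i < d.+1) a i.
have s0 : 0 < s by exact: sum_ord_gt0.
set V := rv_add _ _.
pose E i := B @^-1` [set basis_vec R i].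
have mE i : measurable (E i).
  rewrite -[E i]setTI; apply: measurable_funPT => //.
  exact: measurable_tuple_set1.
have PE i : P (E i) = (a i / s)%:E.
  by rewrite -basis_law_set1 -lB //; exact: measurable_tuple_set1.
have tE : trivIset setT E.
  apply/trivIsetP => i j _ _ /eqP ij; apply/seteqP; split => // w [] /= Bi Bj.
  by apply: ij; apply: (@basis_vec_inj R); rewrite -Bi.
have E1 : (\sum_(i < d.+1) P (E i) = 1)%E.
  under eq_bigr do rewrite PE.
  by rewrite sumEFin -mulr_suml divff // gt_eqF.
pose K := beta_const 1 s.
(* Proportionality of the two laws suffices: the case [A = setT] shows that the constant [K / s] is
   1. *)
suff H A : measurable A -> P (V @^-1` A) = ((K / s)%:E * P (X @^-1` A))%E.
  have K1 : (K / s)%:E = 1%E.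
    have := H setT measurableT; rewrite !preimage_setT probability_setT.
    by rewrite mule1.
  by move=> A mA; rewrite /distribution /pushforward H // K1 mul1e.
move=> mA.
(* On [E i] the vertex is fixed, so membership of [V] in [A] becomes a condition on [Y] and [X]
   alone. *)
pose C i : set (measurableTypeR R * d.+1.-tuple R) :=
  [set p | A (toward_vertex i p.1 p.2)].
have mC i : measurable (C i).
  by rewrite -[C i]setTI; exact: (measurable_toward_vertex i).
have lX' : P (X @^-1` A) = dirichlet_law a A by exact: lX.
rewrite lX' -sum_vertex_integral // ?beta_const_ge0 //.
rewrite (total_probability mE tE E1); last first.
  by rewrite -[X in measurable X]setTI; exact: measurable_funPT.
apply: eq_bigr => i _.
rewrite -integral_beta_dirichlet_vertex //.
have VE w : E i w -> V w = toward_vertex i (Y w) (X w).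
  rewrite /E /V /= => Bi; apply: eq_from_tnth => j.
  by rewrite !tnth_mktuple Bi tnth_mktuple.
have -> : V @^-1` A `&` E i = [set w | C i (Y w, X w)] `&` E i.
  apply/seteqP; split => w /= -[Aw Ew]; split => //;
    by move: Aw; rewrite /C /= VE.
(* The constant [a i / s] is the probability of [E i], which turns the independence of the three
   variables into the required product rule. *)
rewrite (@independent_on_joint_law _ _ _ _ _ _ _ P Y' X (E i) (a i / s)) //;
  last 2 first.
- by rewrite divr_gt0.
- move=> A1 A2 mA1 mA2.
  have := indep _ _ _ mA2 mA1 (measurable_tuple_set1 (basis_vec R i)).
  by rewrite -PE /E [in RHS](muleC (P (X @^-1` _))) [X in P (X `&` _)]setIC.
congr (_ * _)%E.
apply: (@product_law_density _ _ _ _ _ _ _ _ _ P Y' X lebesgue_measure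
  (lebesgue_tuple R d) (fun y => (beta_density 1 s y)%:E)
  (fun x => (dirichlet_density a x)%:E) (@simplex_point R d)).
- by apply/measurable_EFinP; exact: measurable_beta_density1.
- by move=> y; rewrite lee_fin beta_density1_ge0.
- by apply/measurable_EFinP; exact: measurable_dirichlet_density.
- by move=> x; rewrite lee_fin dirichlet_density_ge0.
- exact: measurable_simplex_point.
- exact: lY.
- exact: lX.
- exact: mC.
Qed.
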